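(* Let $l\geq 2$ and let $m_1\leq m_2\leq\cdots\leq m_l$ be positive integers with $m_l>1$ and $\sum_{i=1}^{l}m_i=n$. Let $K_{m_1,m_2,\ldots,m_l}$ be the complete $l$-partite graph and let $k$ be an integer with $0\le k<\Delta(K_{m_1,m_2,\ldots,m_l})$. Then $$s_k^u(K_{m_1,m_2,\ldots,m_l})=\begin{cases} n-\left\lfloor\dfrac{m_l-(k-1)(n-m_l)}{1+n-m_l}\right\rfloor & \text{if } 1\leq k\leq \left\lfloor\dfrac{m_l-1}{n-m_l}\right\rfloor \text{ and } m_l\geq\left\lceil\dfrac{n+1}{2}\right\rceil,\\[2ex] n & \text{otherwise.}\end{cases}$$
   Context: The complete $l$-partite graph $K_{m_1,\ldots,m_l}$ has vertex set partitioned into $V_1,\ldots,V_l$ with $|V_i|=m_i$, no two vertices of the same $V_i$ adjacent, and every vertex of $V_i$ adjacent to all vertices of $V_j$ for $j\ne i$. All graphs are finite, simple and connected. $\Delta(G)$ is the maximum degree of $G=(V,E)$; $N[x]$ is the closed neighborhood of $x$ and $N[X]=\bigcup_{x\in X}N[x]$. For nonempty $S\subseteq V$: $Bord(S)=\{x\in S: N[x]-S\neq\emptyset\}$ and $\partial S=N[S]-S$. For a nonempty proper subset $S$ of $V$: an attack on $S$ is a function $A:\partial S\to Bord(S)$ such that each $x\in\partial S$ is adjacent to $A(x)$; a defense of $S$ is a function $D:N[Bord(S)]\cap S\to Bord(S)$ such that for each $y$ in the domain, $D(y)=y$ or $D(y)$ is adjacent to $y$. For an integer $k$ with $0\le k<\Delta(G)$,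 a defense $D$ of $S$ is an ultra $k$-defense if for every attack $A$ on $S$, $|D^{-1}(x)|-|A^{-1}(x)|\geq k$ for all $x\in Bord(S)$. A nonempty set $S\subseteq V$ is an ultra $k$-secure set if $S=V$ or $S$ has an ultra $k$-defense. The ultra $k$-security number $s_k^u(G)$ is the minimum cardinality of an ultra $k$-secure set in $G$.
   Formalization: The case k = 0 is excluded (k ≥ 1 is assumed), because there the formula gives n, while removing one vertex of the largest part always leaves an ultra 0-secure set of n − 1 vertices. *)

(* Defs.v *)
From mathcomp Require Import all_boot.

Set Implicit Arguments.
Unset Strict Implicit.
Unset Printing Implicit Defensive.

Record sgraph := SGraph {
  vertex :> finType;
  adj : rel vertex;
  adj_sym : symmetric adj;
  adj_irr : irreflexive adj }.

Section Security.
Variable G : sgraph.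
Implicit Types (x y : G) (S X : {set G}).

Definition max_degree : nat := \max_(x : G) #|[set y | adj x y]|.

Definition closed_nbhd x : {set G} := [set y | (y == x) || adj x y].
Definition closed_nbhds X : {set G} := \bigcup_(x in X) closed_nbhd x.

Definition bord S : {set G} := [set x in S | closed_nbhd x :\: S != set0].
Definition boundary S : {set G} := closed_nbhds S :\: S.

(* Attacks and defenses are total functions of which only the values on the
   intended domain matter: they are constrained there only, and preimages are
   taken inside the domain. *)
Definition is_attack S (A : {ffun G -> G}) : bool :=
  [forall x in boundary S, (A x \in bord S) && adj x (A x)].

Definition defense_dom S : {set G} := closed_nbhds (bord S) :&: S.

Definition is_defense S (D : {ffun G -> G}) : bool :=
  [forall y in defense_dom S,
     (D y \in bord S) && ((D y == y) || adj (D y) y)].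

Definition preim_in (dom : {set G}) (f : {ffun G -> G}) x : {set G} :=
  [set y in dom | f y == x].

(* |D^-1(x)| - |A^-1(x)| >= k is written without subtraction. *)
Definition is_ultra_defense (k : nat) S (D : {ffun G -> G}) : bool :=
  is_defense S D &&
  [forall A : {ffun G -> G}, is_attack S A ==>
     [forall x in bord S,
        k + #|preim_in (boundary S) A x| <= #|preim_in (defense_dom S) D x|]].

Definition ultra_secure (k : nat) S : bool :=
  (S != set0) &&
  ((S == setT) || [exists D : {ffun G -> G}, is_ultra_defense k S D]).

Definition ultra_security_number (k : nat) : nat :=
  #|[arg min_(S < [set: G] | ultra_secure k S) #|S|]|.

End Security.

Section CompleteMultipartite.
Variables (l : nat) (m : l.-tuple nat).

Definition multipartite_vertex : finType := {i : 'I_l & 'I_(tnth m i)}.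

Definition multipartite_adj : rel multipartite_vertex :=
  fun u v => tag u != tag v.

Lemma multipartite_adj_sym : symmetric multipartite_adj.
Proof. by move=> u v; rewrite /multipartite_adj eq_sym. Qed.

Lemma multipartite_adj_irr : irreflexive multipartite_adj.
Proof. by move=> u; rewrite /multipartite_adj eqxx. Qed.

Definition complete_multipartite : sgraph :=
  SGraph multipartite_adj_sym multipartite_adj_irr.

End CompleteMultipartite.

(* Main.v *)
Require Import Defs.
From mathcomp Require Import all_boot.
From mathcomp Require Import zify.

Set Implicit Arguments.
Unset Strict Implicit.
Unset Printing Implicit Defensive.

(** Since an attacker may concentrate all the outside neighbours of a border
    vertex [x] on [x], an ultra [k]-defense of [S] is a defense that assigns to
    each border vertex [x] at least [k + #|outer_nbhd S x|] defenders
    ([is_ultra_defenseE]), and a vertex of [S] defends only one border vertex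
    ([ultra_defense_sum]).

    Let [S] be a proper secure set of a complete multipartite graph on [n]
    vertices, let [T] be its complement and [t] the size of [T]. If [T] met two
    parts, every vertex of [S] would see a vertex of [T] and thus need [k + 1] or
    more defenders, which is impossible for [k >= 1]. So [T] lies in one part
    [V_i], of size [m_i]; the border is then the complement of [V_i], each border
    vertex sees all of [T], and summing the demands gives
    [(n - m_i) * (k + t) <= n - t] ([secure_one_part]). Conversely this
    inequality suffices: the border vertices defend themselves and the vertices
    of [V_i] in [S], adjacent to the whole border, are dealt out to it evenly
    ([one_part_secure]).

    The inequality reads [t * (1 + n - m_i) <= m_i - (k - 1) * (n - m_i)], so it is
    weakest for the largest part. There it has a solution [t >= 1] exactly when
    [k * (n - m_l) <= m_l - 1], and the largest solution is the quotient in the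
    formula. *)

(** * Ultra defenses in an arbitrary graph *)

Section Defenses.
Variable G : sgraph.
Implicit Types (x y : G) (S : {set G}) (D : {ffun G -> G}).

Definition outer_nbhd S x : {set G} := [set y in ~: S | adj x y].

Lemma bordE S x : (x \in bord S) = (x \in S) && (outer_nbhd S x != set0).
Proof.
rewrite inE; case xS: (x \in S) => //=; congr (_ != set0).
apply/setP=> y; rewrite !inE; case: eqVneq => [->|_] //=.
by rewrite xS.
Qed.

Lemma outer_nbhd_boundary S x y :
  x \in S -> y \in outer_nbhd S x -> y \in boundary S.
Proof.
rewrite !inE => xS /andP[-> xy] /=.
by apply/bigcupP; exists x => //; rewrite inE xy orbT.
Qed.

Lemma boundary_outer_nbhd S y :
  y \in boundary S -> exists2 x, x \in bord S & y \in outer_nbhd S x.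
Proof.
rewrite inE => /andP[yS /bigcupP[x xS]]; rewrite inE => /orP[/eqP yx|xy].
  by rewrite yx xS in yS.
have yx : y \in outer_nbhd S x by rewrite !inE yS.
by exists x => //; rewrite bordE xS; apply/set0Pn; exists y.
Qed.

(** The attacks can be eliminated from the definition: for each border vertex
    there is a worst attack, in which all the outside neighbours of that vertex
    strike it at once. *)
Lemma is_ultra_defenseE k S D :
  is_ultra_defense k S D =
  is_defense S D &&
  [forall x in bord S,
     k + #|outer_nbhd S x| <= #|preim_in (defense_dom S) D x|].
Proof.
rewrite /is_ultra_defense; case: (is_defense S D) => //=.
apply/forall_inP/forall_inP => [attackD x xB | nbhdD A attA].
  have xS : x \in S by move: xB; rewrite bordE => /andP[].
  pose A := [ffun y => if y \in outer_nbhd S x then x else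
               odflt x [pick z in bord S | adj y z]].
  have attA : is_attack S A.
    apply/forall_inP => y yB; rewrite ffunE.
    case: ifP => [|_]; first by rewrite xB inE adj_sym => /andP[].
    (* The default value of the choice never occurs: outside vertices that do not
       see [x] have another border neighbour to strike. *)
    have [z zB] := boundary_outer_nbhd yB; rewrite inE => /andP[_ zy].
    case: pickP => [w //|/(_ z)]; by rewrite /= zB adj_sym zy.
  have /forall_inP/(_ x xB) := attackD A attA.
  apply: leq_trans; rewrite leq_add2l subset_leq_card //.
  apply/subsetP => y yx; rewrite inE (outer_nbhd_boundary xS yx) /=.
  by rewrite ffunE yx.
apply/forall_inP => x xB; apply: leq_trans (nbhdD x xB).
rewrite leq_add2l subset_leq_card //; apply/subsetP => y.
rewrite inE => /andP[yB /eqP Ayx].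
have /forall_inP/(_ y yB) := attA; rewrite Ayx => /andP[_ yx].
by move: yB; rewrite !inE => /andP[-> _]; rewrite adj_sym.
Qed.

(** Each vertex of [S] defends only one border vertex, so the fibres of [D] over
    the border are disjoint. *)
Lemma ultra_defense_sum k S D :
  is_ultra_defense k S D ->
  \sum_(x in bord S) (k + #|outer_nbhd S x|) <= #|S|.
Proof.
rewrite is_ultra_defenseE => /andP[/forall_inP defD /forall_inP demD].
apply: (@leq_trans #|defense_dom S|); last exact/subset_leq_card/subsetIr.
rewrite -sum1_card [leqRHS](partition_big D (mem (bord S))) => [|y yS]; last first.
  by have /andP[] := defD y yS.
apply: leq_sum => x /demD /leq_trans; apply.
by rewrite -sum1_card; under eq_bigl do rewrite inE.
Qed.

Lemma ultra_security_numberE k S :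
  ultra_secure k S ->
  (forall S' : {set G}, ultra_secure k S' -> #|S| <= #|S'|) ->
  ultra_security_number G k = #|S|.
Proof.
move=> secS minS; have secT : @ultra_secure G k setT.
  rewrite /ultra_secure eqxx andbT; case/andP: secS => /set0Pn[x _] _.
  by apply/set0Pn; exists x.
rewrite /ultra_security_number; case: arg_minnP => // S0 secS0 minS0.
by apply/eqP; rewrite eqn_leq minS0 ?minS.
Qed.

End Defenses.

(** Dealing the elements of [A] out to [B] in turn, as one deals cards, gives
    everybody the guaranteed share. *)
Lemma large_fibres (T : finType) (A B : {set T}) q :
  B != set0 -> q * #|B| <= #|A| ->
  exists f : T -> T,
    (forall a, f a \in B) /\
    (forall b, b \in B -> q <= #|[set a in A | f a == b]|).
Proof.
case/set0Pn => b0 b0B leqA.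
have B_gt0 : 0 < #|B| by apply/card_gt0P; exists b0.
pose f a := nth b0 (enum B) (index a (enum A) %% #|B|).
exists f; split=> [a|b bB].
  by rewrite -mem_enum mem_nth // -cardE ltn_pmod.
(* The [c]-th round of the deal gives [b] the element of [A] at [pos c]. *)
have bltB : index b (enum B) < #|B| by rewrite cardE index_mem mem_enum.
pose pos (c : 'I_q) := c * #|B| + index b (enum B).
have posA c : pos c < size (enum A).
  by rewrite -cardE; apply: leq_trans leqA; rewrite /pos; have := ltn_ord c; nia.
pose g c := nth b0 (enum A) (pos c).
have g_inj : injective g.
  move=> c d /eqP; rewrite nth_uniq ?enum_uniq // eqn_add2r eqn_pmul2r //.
  by move/eqP/val_inj.
rewrite -[q]card_ord -cardsT -(card_imset _ g_inj) subset_leq_card //.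
apply/subsetP => _ /imsetP[c _ ->]; rewrite inE -mem_enum mem_nth //=.
rewrite /f /g index_uniq ?enum_uniq // /pos modnMDl modn_small //.
by rewrite nth_index ?mem_enum.
Qed.

Lemma exists_subset_card (T : finType) (A : {set T}) t :
  t <= #|A| -> exists2 B : {set T}, B \subset A & #|B| = t.
Proof.
move=> tA; have := bin_gt0 #|A| t; rewrite tA -cards_draws => /card_gt0P[B].
by rewrite inE => /andP[sBA /eqP cB]; exists B.
Qed.

(** * Secure sets of complete multipartite graphs *)

Section Multipartite.
Variables (l : nat) (m : l.-tuple nat).
Hypothesis l_gt1 : 1 < l.
Hypothesis m_gt0 : forall i : 'I_l, 0 < tnth m i.
Notation G := (complete_multipartite m).
Implicit Types (x y : G) (S : {set G}).

Definition part (i : 'I_l) : {set G} := [set v : G | tag v == i].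

Lemma card_part i : #|part i| = tnth m i.
Proof.
rewrite cardsE -[RHS]card_ord -card_sig; apply/esym.
exact: bij_eq_card (tag_with_bij (fun i => 'I_(tnth m i)) i).
Qed.

Lemma card_multipartite : #|G| = \sum_(i < l) tnth m i.
Proof.
rewrite card_tagged sumnE big_map big_enum.
by apply: eq_bigr => i _; exact: card_ord.
Qed.

Lemma partC_neq0 i : ~: part i != set0.
Proof.
have [j ji] : exists j : 'I_l, j != i.
  have : 0 < #|[set~ i]| by rewrite cardsC1 card_ord; lia.
  by case/card_gt0P => j; rewrite !inE; exists j.
apply/set0Pn; exists (Tagged (fun i => 'I_(tnth m i)) (Ordinal (m_gt0 j))).
by rewrite !inE.
Qed.

Lemma outer_nbhd_multipartite S x : outer_nbhd S x = ~: S :\: part (tag x).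
Proof.
by apply/setP => y; rewrite !inE andbC; congr (_ && _); rewrite eq_sym.
Qed.

Section OnePartComplement.
Variables (S : {set G}) (i : 'I_l).
Hypotheses (S_neqT : S != setT) (subCS : ~: S \subset part i).

Lemma outer_nbhd_one_part x : x \in ~: part i -> outer_nbhd S x = ~: S.
Proof.
rewrite outer_nbhd_multipartite => xi; apply/setDidPl.
rewrite disjoints_subset; apply: subset_trans subCS _.
by apply/subsetP => y; move: xi; rewrite !inE => xi /eqP->; rewrite eq_sym.
Qed.

Lemma bord_one_part : bord S = ~: part i.
Proof.
apply/setP => x; rewrite bordE; apply/andP/idP => [[_]|xi]; last first.
  rewrite outer_nbhd_one_part //; split.
    by apply: contraLR xi => xS; rewrite inE negbK (subsetP subCS) ?inE.
  by apply: contra S_neqT => /eqP CS0; rewrite -[S]setCK CS0 setC0.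
rewrite outer_nbhd_multipartite; apply: contraR.
rewrite !inE negbK => /eqP->; by rewrite setD_eq0.
Qed.

Lemma defense_dom_one_part : defense_dom S = S.
Proof.
apply/setIidPr/subsetP => y yS; rewrite bord_one_part.
have [yi|yi] := boolP (y \in part i); last first.
  by apply/bigcupP; exists y; rewrite ?inE ?eqxx //; move: yi; rewrite inE.
have /set0Pn[b bi] := partC_neq0 i; apply/bigcupP; exists b => //.
move: bi yi; rewrite !inE => bi /eqP yi.
by apply/orP; right; change (tag b != tag y); rewrite yi.
Qed.

(** The vertices of [S] in [part i] are free to help any border vertex, and the
    border vertices defend themselves: what remains is a matter of counting
    the helpers. *)
Lemma one_part_secure k :
  0 < k -> #|~: part i| * (k + #|~: S|) <= #|S| -> ultra_secure k S.
Proof.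
move=> k_gt0 leS.
have cardS : #|S| = #|S :&: part i| + #|~: part i|.
  rewrite -(cardsID (part i) S); congr (_ + #|pred_of_set _|).
  apply/setP => y; rewrite !inE andbC.
  case yS: (y \in S); rewrite ?andbT ?andbF //.
  by have := subsetP subCS y; rewrite !inE yS => ->.
have [f [fB fibre]] : exists f : G -> G,
    (forall a, f a \in ~: part i) /\
    (forall b, b \in ~: part i ->
       (k + #|~: S|).-1 <= #|[set a in S :&: part i | f a == b]|).
  (* A border vertex is its own first defender, hence the predecessor. *)
  by apply: large_fibres; [exact: partC_neq0 | nia].
have S_neq0 : S != set0.
  rewrite -card_gt0 cardS addn_gt0; apply/orP; right.
  by rewrite card_gt0 partC_neq0.
rewrite /ultra_secure S_neq0; apply/orP; right; apply/existsP.
exists [ffun y => if y \in part i then f y else y].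
rewrite is_ultra_defenseE bord_one_part /preim_in /is_defense.
rewrite defense_dom_one_part bord_one_part.
apply/andP; split; apply/forall_inP => x xS.
  rewrite ffunE; case: ifP => xi; last by rewrite inE xi eqxx.
  rewrite fB; apply/orP; right; move: (fB x) xi; rewrite !inE => fx /eqP xi.
  by change (tag (f x) != tag x); rewrite xi.
rewrite outer_nbhd_one_part //.
have xC : x \notin [set a in S :&: part i | f a == x].
  by move: xS; rewrite !inE => /negPf->; rewrite andbF.
apply: (@leq_trans #|x |: [set a in S :&: part i | f a == x]|).
  by rewrite cardsU1 xC; have := fibre x xS; lia.
have xinS : x \in S.
  by have := xS; rewrite -bord_one_part bordE => /andP[].
apply/subset_leq_card/subsetP => y; rewrite in_setU1 => /orP[/eqP->|].
  by rewrite inE xinS ffunE ifN ?eqxx //; move: xS; rewrite inE.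
by rewrite !inE ffunE inE => /andP[/andP[-> ->] ->].
Qed.

End OnePartComplement.

(** If the complement of [S] met two parts, every vertex of [S] would have an
    outside neighbour and so need at least [k + 1 > 1] defenders, more in total
    than [S] can supply. *)
Lemma secure_one_part k S :
  0 < k -> S != setT -> ultra_secure k S ->
  exists2 i, ~: S \subset part i & #|~: part i| * (k + #|~: S|) <= #|S|.
Proof.
move=> k_gt0 SnT; rewrite /ultra_secure (negPf SnT) /=.
case/andP => S_neq0 /existsP[D /ultra_defense_sum leS].
case: (pickP (fun i => ~: S \subset part i)) => [i sub_i|two_parts].
  exists i => //; apply: leq_trans leS.
  rewrite -sum_nat_const (bord_one_part SnT sub_i); apply: leq_sum => x xi.
  by rewrite (outer_nbhd_one_part sub_i xi).
have outer_neq0 x : outer_nbhd S x != set0.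
  by rewrite outer_nbhd_multipartite setD_eq0 two_parts.
have bordS : bord S = S by apply/setP => x; rewrite bordE outer_neq0 andbT.
have : \sum_(x in S) 2 <= #|S|.
  apply: leq_trans leS; rewrite bordS; apply: leq_sum => x _.
  by apply: (@leq_add 1 1) => //; rewrite card_gt0.
by rewrite sum_nat_const leqNgt ltn_Pmulr // card_gt0.
Qed.

End Multipartite.

(** * The security number *)

(* The case k = 0 is excluded, because the formula fails there for every such
   graph: for v in the largest part, V \ {v} is ultra 0-secure, so that the
   ultra 0-security number is at most n - 1, whereas the formula gives n. *)
Theorem theorem4p2 (l : nat) (m : l.-tuple nat) (n k : nat)
  (hl : 2 <= l)
  (hsorted : sorted leq m)
  (hpos : forall i : 'I_l, 0 < tnth m i)
  (hlast : 1 < last 0 m)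
  (hn : \sum_(i < l) tnth m i = n)
  (hk : 0 < k < max_degree (complete_multipartite m)) :
  let ml := last 0 m in
  ultra_security_number (complete_multipartite m) k =
    if (1 <= k <= (ml - 1) %/ (n - ml)) && (uphalf n.+1 <= ml)
    then n - (ml - (k - 1) * (n - ml)) %/ (1 + n - ml)
    else n.
Proof.
move=> ml; case/andP: hk => k_gt0 _.
have llt : l.-1 < l by lia.
pose i0 := Ordinal llt.
have mi0 : tnth m i0 = ml.
  by rewrite (tnth_nth 0) /ml -nth_last size_tuple.
have leml i : tnth m i <= ml.
  rewrite -mi0 !(tnth_nth 0).
  apply: (sorted_leq_nth leq_trans leqnn) => //; rewrite ?inE ?size_tuple //=.
  by have := ltn_ord i; lia.
have cardG : #|complete_multipartite m| = n by rewrite card_multipartite.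
have cardC i : #|~: part m i| = n - tnth m i.
  by rewrite -(card_part m i) -cardG -(cardsC (part m i)) addKn.
have ml_lt : ml < n.
  by have := partC_neq0 hl hpos i0; rewrite -card_gt0 cardC mi0 subn_gt0.
have CardS (S : {set complete_multipartite m}) : #|S| + #|~: S| = n.
  by rewrite cardsC.
have secT : @ultra_secure (complete_multipartite m) k setT.
  rewrite /ultra_secure eqxx andbT; apply/set0Pn.
  by case/set0Pn: (partC_neq0 hl hpos i0) => x _; exists x.
(* The smaller the part that contains the complement, the larger the border and
   thus the total demand. *)
have leave_out (S : {set complete_multipartite m}) :
    S != setT -> ultra_secure k S ->
    (n - ml) * (k + #|~: S|) <= n - #|~: S|.
  move=> SnT /(secure_one_part k_gt0 SnT)[i _]; rewrite cardC => leS.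
  rewrite -(CardS S) addnK; apply: leq_trans leS; rewrite leq_mul2r.
  by rewrite (CardS S) leq_sub2l ?orbT.
have CS_gt0 (S : {set complete_multipartite m}) : S != setT -> 0 < #|~: S|.
  rewrite card_gt0; apply: contra => /eqP CS0; by rewrite -[S]setCK CS0 setC0.
set p := n - ml in leave_out *; have p_gt0 : 0 < p by rewrite subn_gt0.
have -> : 1 + n - ml = p.+1 by lia.
rewrite leq_divRL // k_gt0 /=.
case: ifP => [/andP[lek _] | noSmall]; last first.
  rewrite -cardG -cardsT; apply: ultra_security_numberE => // S secS.
  have [-> //|SnT] := eqVneq S setT.
  (* Here [ml - 1 < k * p], because [1 <= k] and [k * p <= ml - 1] would give
     [n < 2 * ml]; so no [t >= 1] meets the bound. *)
  by have := leave_out S SnT secS; have := CS_gt0 S SnT; move: noSmall; nia.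
pose t := (ml - (k - 1) * p) %/ p.+1.
have t_le : t * p.+1 <= ml - (k - 1) * p by exact: leq_divM.
have t_gt0 : 0 < t by rewrite divn_gt0 //; nia.
have [T subT cT] : exists2 T : {set complete_multipartite m},
    T \subset part m i0 & #|T| = t.
  by apply: exists_subset_card; rewrite card_part mi0; nia.
have cCT : #|~: T| = n - t by have := CardS T; lia.
rewrite -/t -cCT; apply: ultra_security_numberE => [|S secS].
  apply: (@one_part_secure _ _ hl hpos _ i0) => //.
  - by rewrite -setC0 (inj_eq (@setC_inj _)) -card_gt0 cT.
  - by rewrite setCK.
  by rewrite setCK cardC mi0 cT cCT -/p; nia.
have [->|SnT] := eqVneq S setT; first by rewrite cardsT max_card.
have bound : #|~: S| <= t.
  by rewrite leq_divRL //; have := leave_out S SnT secS; have := CardS S; nia.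
by rewrite cCT; have := CardS S; lia.
Qed.
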